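(* Mean-payoff automaton expressions are incomparable in expressive power with nondeterministic and alternating mean-payoff automata: (a) there exists a quantitative language that is expressible by a mean-payoff automaton expression but cannot be expressed by any alternating mean-payoff automaton; and (b) there exists a quantitative language that is expressible by a nondeterministic mean-payoff automaton but cannot be expressed by any mean-payoff automaton expression.
   Context: A quantitative language over finite alphabet $\Sigma$ is a function $\Sigma^\omega\to\mathbb{R}$. A $\mathbb{Q}$-weighted automaton is $A=\langle Q,q_I,\Sigma,\delta,\mathsf{wt}\rangle$ with finite $Q$, initial $q_I$, total $\delta\subseteq Q\times\Sigma\times Q$, $\mathsf{wt}:\delta\to\mathbb{Q}$; runs on $w$ start at $q_I$ and follow $\delta$, yielding weight sequences $v_0v_1\dots$. With $\mathsf{Val}\in\{\mathsf{LimInfAvg},\mathsf{LimSupAvg}\}$ ($\liminf$ resp. $\limsup$ of $\frac1n\sum_{i<n}v_i$), a nondeterministic mean-payoff automaton defines $L_A(w)=\sup_r\mathsf{Val}(\mathsf{wt}(r))$ over runs $r$ on $w$; it is deterministic if each state and letter has exactly one successor. An alternating mean-payoff automaton additionally partitions $Q$ into existential and universal states, and $L_A(w)$ is the value of the game on $w$ where a maximizer resolves transitions at existential states and a minimizer at universal states, with payoff $\mathsf{Val}$ of the resulting run's weight sequence. A mean-payoff automaton expression is generated by $E::=A\mid\max(E,E)\mid\min(E,E)\mid\mathrm{sum}(E,E)$, $A$ a deterministic $\mathsf{LimInfAvg}$- or $\mathsf{LimSupAvg}$-automaton, interpreted pointwise on quantitative languages. *)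

(* Defs.v *)
From HB Require Import structures.
From mathcomp Require Import all_boot all_order all_algebra.
From mathcomp Require Import all_classical all_reals all_analysis.

Set Implicit Arguments.
Unset Strict Implicit.
Unset Printing Implicit Defensive.

Import Order.TTheory GRing.Theory Num.Theory.

Local Open Scope classical_set_scope.
Local Open Scope ring_scope.

Definition word (Sigma : finType) : Type := nat -> Sigma.

Definition qlang (R : realType) (Sigma : finType) : Type := word Sigma -> R.

(* The weight function is given on all triples, but it is only ever read on
   transitions. *)
Record wautomaton (Sigma : finType) := WAutomaton {
  state : finType;
  init : state;
  trans : state -> Sigma -> state -> bool;
  trans_total : forall q a, exists q', trans q a q';
  wt : state -> Sigma -> state -> rat }.

Definition deterministic (Sigma : finType) (A : wautomaton Sigma) : Prop :=
  forall (q : state A) (a : Sigma), exists! q' : state A, trans q a q'.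

(* All values below are taken in \bar R, so that infima, suprema and limits are
   total; weights being bounded, the resulting values are always finite. *)
Inductive value_function := LimInfAvg | LimSupAvg.

(* The average of index 0 is 0 by convention; it does not affect the limits. *)
Definition averages (R : realType) (v : nat -> rat) (n : nat) : \bar R :=
  ((n%:R)^-1 * \sum_(i < n) ratr (v i))%:E.

Definition Val (R : realType) (f : value_function) (v : nat -> rat) : \bar R :=
  match f with
  | LimInfAvg => limn_einf (averages R v)
  | LimSupAvg => limn_esup (averages R v)
  end.

Definition is_run (Sigma : finType) (A : wautomaton Sigma) (w : word Sigma)
    (r : nat -> state A) : Prop :=
  r 0%N = init A /\ forall i, trans (r i) (w i) (r i.+1).

Definition run_weights (Sigma : finType) (A : wautomaton Sigma)
    (w : word Sigma) (r : nat -> state A) : nat -> rat :=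
  fun i => wt (r i) (w i) (r i.+1).

Definition nondet_value (R : realType) (Sigma : finType) (f : value_function)
    (A : wautomaton Sigma) (w : word Sigma) : \bar R :=
  ereal_sup [set Val R f (run_weights w r) | r in is_run (A := A) w].

Record altautomaton (Sigma : finType) := AltAutomaton {
  alt_aut :> wautomaton Sigma;
  existential : pred (state alt_aut) }.

(* [s h q] is the successor chosen in state [q] after the past [h], which lists
   the previously visited states, the most recent one first; the letter to be
   read is thus the one at position [size h]. *)
Definition strategy (Q : finType) : Type := seq Q -> Q -> Q.

Definition legal (Sigma : finType) (A : wautomaton Sigma) (w : word Sigma)
    (P : pred (state A)) : set (strategy (state A)) :=
  [set s | forall h q, P q -> trans q (w (size h)) (s h q)].

Fixpoint play (Sigma : finType) (A : altautomaton Sigma)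
    (smax smin : strategy (state A)) (n : nat) : seq (state A) * state A :=
  match n with
  | 0 => ([::], init A)
  | m.+1 =>
      let: (h, q) := play smax smin m in
      (q :: h, if existential q then smax h q else smin h q)
  end.

Definition outcome (Sigma : finType) (A : altautomaton Sigma)
    (smax smin : strategy (state A)) : nat -> state A :=
  fun n => (play smax smin n).2.

(* The payoff is a Borel function, so the game is determined and the order of
   the supremum and of the infimum is immaterial. *)
Definition alt_value (R : realType) (Sigma : finType) (f : value_function)
    (A : altautomaton Sigma) (w : word Sigma) : \bar R :=
  ereal_sup [set
    ereal_inf [set Val R f (run_weights w (outcome smax smin))
              | smin in legal w (predC (@existential Sigma A))]
    | smax in legal w (@existential Sigma A)].

Inductive mpexpr (Sigma : finType) :=
  | EAut (f : value_function) (A : wautomaton Sigma) of deterministic A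
  | EMax of mpexpr Sigma & mpexpr Sigma
  | EMin of mpexpr Sigma & mpexpr Sigma
  | ESum of mpexpr Sigma & mpexpr Sigma.

(* On a deterministic automaton the supremum in [nondet_value] ranges over the
   unique run. *)
Fixpoint expr_value (R : realType) (Sigma : finType) (e : mpexpr Sigma)
    (w : word Sigma) : \bar R :=
  match e with
  | EAut f A _ => nondet_value R f A w
  | EMax e1 e2 => Order.max (expr_value R e1 w) (expr_value R e2 w)
  | EMin e1 e2 => Order.min (expr_value R e1 w) (expr_value R e2 w)
  | ESum e1 e2 => (expr_value R e1 w + expr_value R e2 w)%E
  end.

Definition expr_expressible (R : realType) (Sigma : finType)
    (L : qlang R Sigma) : Prop :=
  exists e : mpexpr Sigma, forall w, expr_value R e w = (L w)%:E.

Definition nondet_expressible (R : realType) (Sigma : finType)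
    (L : qlang R Sigma) : Prop :=
  exists (f : value_function) (A : wautomaton Sigma),
    forall w, nondet_value R f A w = (L w)%:E.

Definition alt_expressible (R : realType) (Sigma : finType)
    (L : qlang R Sigma) : Prop :=
  exists (f : value_function) (A : altautomaton Sigma),
    forall w, alt_value R f A w = (L w)%:E.

(* Main.v *)
Require Import Defs.
From mathcomp Require Import all_boot all_order all_algebra.
From mathcomp Require Import all_classical all_reals all_analysis.
From mathcomp Require Import ring lra zify.

(* (a) Reading [true] as 1 and [false] as -1, take the sum of the inferior and
   of the superior limit average. Suppose that an alternating LimInfAvg
   automaton expresses it. On the word (true^k false^3k)^omega the value is -1,
   so the minimizer, owner of the universal states, can keep the excess of the
   total weight over -3/4 per letter bounded when starting from the initial
   state: otherwise the maximizer could enforce an average of at least -3/4.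
   The set of states from which the excess can be kept bounded is invariant
   under optimal play over one period, and it is the same set for infinitely
   many k. Hence the minimizer can play well on a word made of many repetitions
   of true^k false^3k, followed by many repetitions for a much larger k, and so
   on; at the end of each phase the average weight is at most -5/8. But on such
   a word the superior limit average is at least 1/2, so the value is at least
   -1/2. LimSupAvg automata are reduced to this case by negating weights,
   exchanging the players and exchanging the two letters; since only strategies
   of one player against all strategies of the other are used, no determinacy
   is needed.

   (b) In each block over {a, b} ended by a separator, a nondeterministic
   automaton can guess which letter to count. With N a large factorial, a
   deterministic automaton goes to the same state after the blocks a^3N b^N,
   a^N b^3N and a^2N b^2N, and its total weight on the first two is twice its
   weight on the third. So N blocks of the first kind followed by N blocks of
   the second kind, repeated forever, get the same value as blocks of the third
   kind from every small deterministic automaton, hence from an expression,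
   while the nondeterministic automaton gets about 3/4 and 1/2. *)

Set Implicit Arguments.
Unset Strict Implicit.
Unset Printing Implicit Defensive.

Import Order.TTheory GRing.Theory Num.Theory.

Local Open Scope classical_set_scope.
Local Open Scope ring_scope.

(** * Partial sums and limit averages *)

Definition psum (v : nat -> rat) (n : nat) : rat := \sum_(i < n) v i.

Lemma psumS v n : psum v n.+1 = psum v n + v n.
Proof. by rewrite /psum big_ord_recr. Qed.

Lemma psumN v n : psum (fun i => - v i) n = - psum v n.
Proof. by rewrite /psum sumrN. Qed.

Lemma psumD v m n : psum v (m + n) = psum v m + psum (fun i => v (m + i)%N) n.
Proof. by rewrite /psum big_split_ord. Qed.

Lemma psum_le (v : nat -> rat) M n :
  (forall i, v i <= M) -> psum v n <= n%:R * M.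
Proof.
move=> vM; elim: n => [|n IH]; first by rewrite /psum big_ord0 mul0r.
by rewrite psumS -natr1 mulrDl mul1r lerD.
Qed.

Lemma psum_ge (v : nat -> rat) M n :
  (forall i, M <= v i) -> n%:R * M <= psum v n.
Proof.
move=> vM; elim: n => [|n IH]; first by rewrite /psum big_ord0 mul0r.
by rewrite psumS -natr1 mulrDl mul1r lerD.
Qed.

(** The incomplete last block adds at most [l%:R * M], and rounding down to the number of complete
    blocks costs at most [|W|]. *)
Lemma psum_block_le (v : nat -> rat) (M W C : rat) (l : nat) : (0 < l)%N ->
  (forall i, `|v i| <= M) -> (forall j, psum v (j * l) <= j%:R * W + C) ->
  exists C', forall n, psum v n <= W / l%:R * n%:R + C'.
Proof.
move=> l0 vM h.
have M0 : 0 <= M by apply: le_trans (vM 0%N).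
exists (C + l%:R * M + `|W|) => n.
rewrite {1}(divn_eq n l) psumD.
have h1 : psum (fun i => v (n %/ l * l + i)%N) (n %% l) <= l%:R * M.
  apply: le_trans (psum_le _ (M := M) _) _ => [i|].
    by apply: le_trans (ler_norm _) (vM _).
  by rewrite ler_wpM2r // ler_nat ltnW // ltn_mod.
have h2 : (n %/ l)%:R * W <= W / l%:R * n%:R + `|W|.
  have -> : (n%:R : rat) = (n %/ l)%:R * l%:R + (n %% l)%:R.
    by rewrite {1}(divn_eq n l) natrD natrM.
  rewrite mulrDr mulrA mulrAC divfK ?pnatr_eq0 -?lt0n // mulrC -addrA lerDl.
  rewrite mulrAC -mulrA -lerBlDl sub0r.
  apply: le_trans (ler_norm _) _; rewrite normrN normrM -[leRHS]mulr1.
  rewrite ler_wpM2l // ger0_norm ?divr_ge0 //.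
  by rewrite ler_pdivrMr ?ltr0n // mul1r ler_nat ltnW // ltn_mod.
have := h (n %/ l)%N; lra.
Qed.

Lemma psum_block_ge (v : nat -> rat) (M W C : rat) (l : nat) : (0 < l)%N ->
  (forall i, `|v i| <= M) -> (forall j, j%:R * W + C <= psum v (j * l)) ->
  exists C', forall n, W / l%:R * n%:R + C' <= psum v n.
Proof.
move=> l0 vM h.
have [i|j|C' hC] := @psum_block_le (fun i => - v i) M (- W) (- C) l l0.
- by rewrite normrN.
- by rewrite psumN mulrN -opprD lerN2.
- by exists (- C') => n; have := hC n; rewrite psumN mulNr mulNr; lra.
Qed.

(** * Limit averages from linear bounds on partial sums *)

Section Val_bounds.
Variable R : realType.
Local Open Scope ereal_scope.

Lemma averagesE v n :
  averages R v n = ((n%:R)^-1 * ratr (psum v n))%:E.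
Proof. by rewrite /averages /psum rmorph_sum. Qed.

Lemma averagesN v : averages R (fun i => - v i)%R = \- (averages R v).
Proof.
by apply/funext => n; rewrite !averagesE psumN rmorphN mulrN EFinN.
Qed.

Lemma limn_esup_le (u : (\bar R)^nat) (l : R) :
  (forall e, (0 < e)%R ->
     exists N, forall n, (N <= n)%N -> u n <= (l + e)%:E) ->
  limn_esup u <= l%:E.
Proof.
move=> h; apply/lee_addgt0Pr => e e0; have [N hN] := h _ e0.
apply: ge_ereal_inf; exists (ereal_sup (u @` [set n | (N <= n)%N])).
  by exists [set n | (N <= n)%N] => //; exists N.
by apply: ge_ereal_sup => _ [n nN <-]; rewrite -EFinD; exact: hN.
Qed.

Lemma limn_esup_ge (u : (\bar R)^nat) (l : \bar R) :
  (forall N, exists2 n, (N <= n)%N & l <= u n) -> l <= limn_esup u.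
Proof.
move=> h; apply: le_ereal_inf_tmp => _ [V [N _ NV] <-].
have [n Nn ln] := h N; apply: le_trans ln _.
by apply: ereal_sup_ubound; exists n => //; exact: NV.
Qed.

Lemma Val_LimSup_ge (v : nat -> rat) (c : rat) :
  (forall N, exists2 n, (N <= n)%N & (c * n%:R <= psum v n)%R) ->
  (ratr c)%:E <= Val R LimSupAvg v.
Proof.
(* Asking for an index above [N] makes [n] positive. *)
move=> h; apply: limn_esup_ge => N; have [n Nn cn] := h N.+1.
exists n; first exact: ltnW.
have n0 : (0 < n%:R :> R)%R by rewrite ltr0n (leq_trans _ Nn).
rewrite averagesE lee_fin mulrC ler_pdivlMr //.
by rewrite -[n%:R]ratr_nat -rmorphM ler_rat.
Qed.

Lemma Val_LimSup_le (v : nat -> rat) (c C : rat) :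
  (forall n, (psum v n <= c * n%:R + C)%R) ->
  Val R LimSupAvg v <= (ratr c)%:E.
Proof.
move=> h; apply: limn_esup_le => e e0.
have [N NC] : exists N, (ratr C / e <= N%:R)%R.
  exists (Num.bound `|ratr C / e|%R); apply/ltW/(le_lt_trans (ler_norm _)).
  exact: archi_boundP.
exists N.+1 => n Nn.
have n0 : (0 < n%:R :> R)%R by rewrite ltr0n (leq_trans _ Nn).
rewrite averagesE lee_fin mulrC ler_pdivrMr //.
have : (ratr (psum v n) <= ratr c * n%:R + ratr C :> R)%R.
  by rewrite -[n%:R]ratr_nat -rmorphM -rmorphD ler_rat.
move=> /le_trans; apply; rewrite mulrDl lerD2l -ler_pdivrMl // mulrC.
by apply: le_trans NC _; rewrite ler_nat ltnW.
Qed.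

Lemma Val_LimInfN v : Val R LimInfAvg v = - Val R LimSupAvg (fun i => - v i)%R.
Proof. by rewrite /Val averagesN. Qed.

Lemma Val_LimInf_le (v : nat -> rat) (c : rat) :
  (forall N, exists2 n, (N <= n)%N & (psum v n <= c * n%:R)%R) ->
  Val R LimInfAvg v <= (ratr c)%:E.
Proof.
move=> h; rewrite Val_LimInfN leeNl -EFinN -rmorphN.
apply: Val_LimSup_ge => N; have [n Nn cn] := h N.
by exists n => //; rewrite psumN mulNr lerN2.
Qed.

Lemma Val_LimInf_ge (v : nat -> rat) (c C : rat) :
  (forall n, (c * n%:R + C <= psum v n)%R) ->
  (ratr c)%:E <= Val R LimInfAvg v.
Proof.
move=> h; rewrite Val_LimInfN leeNr -EFinN -rmorphN.
apply: (@Val_LimSup_le _ _ (- C)) => n.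
by rewrite psumN mulNr -opprD lerN2.
Qed.

Lemma Val_le (f : value_function) (v : nat -> rat) (c C : rat) :
  (forall n, (psum v n <= c * n%:R + C)%R) -> Val R f v <= (ratr c)%:E.
Proof.
move=> h; have hs := Val_LimSup_le h.
by case: f => //; apply: le_trans (limn_einf_sup _) hs.
Qed.

Lemma Val_ge (f : value_function) (v : nat -> rat) (c C : rat) :
  (forall n, (c * n%:R + C <= psum v n)%R) -> (ratr c)%:E <= Val R f v.
Proof.
move=> h; have hs := Val_LimInf_ge h.
by case: f => //; apply: le_trans hs (limn_einf_sup _).
Qed.

End Val_bounds.

(** * Games on a fixed word *)

Definition repeat_word (Sigma : finType) (x0 : Sigma) (u : seq Sigma) :
    word Sigma :=
  fun n => nth x0 u (n %% size u).

Lemma repeat_word_block (Sigma : finType) (x0 : Sigma) (u : seq Sigma) i k :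
  (k < size u)%N -> repeat_word x0 u (i * size u + k) = nth x0 u k.
Proof. by move=> ku; rewrite /repeat_word modnMDl modn_small. Qed.

Lemma psum_repeat_word (Sigma : finType) (x0 : Sigma) (u : seq Sigma)
    (g : Sigma -> rat) j :
  psum (fun i => g (repeat_word x0 u i)) (j * size u) =
  j%:R * \sum_(x <- u) g x.
Proof.
elim: j => [|j IH]; first by rewrite /psum big_ord0 mul0r.
rewrite mulSn addnC psumD IH -natr1 mulrDl mul1r; congr (_ + _).
rewrite (big_nth x0) big_mkord; apply: eq_bigr => i _.
by rewrite repeat_word_block.
Qed.

Definition powseq (T : Type) (u : seq T) (n : nat) : seq T :=
  flatten (nseq n u).

Lemma size_powseq (T : Type) (u : seq T) n :
  size (powseq u n) = (n * size u)%N.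
Proof. by rewrite size_flatten /shape map_nseq sumn_nseq mulnC. Qed.

(** The past in the format that strategies read: latest state first, current state left out. *)
Fixpoint history (Q : Type) (r : nat -> Q) (n : nat) : seq Q :=
  if n is m.+1 then r m :: history r m else [::].

Lemma size_history (Q : Type) (r : nat -> Q) n : size (history r n) = n.
Proof. by elim: n => //= n ->. Qed.

Lemma play_history (Sigma : finType) (A : altautomaton Sigma)
    (smax smin : strategy (state A)) n :
  play smax smin n = (history (outcome smax smin) n, outcome smax smin n).
Proof.
elim: n => [//|n IH].
by rewrite {2}/outcome /= IH.
Qed.

Lemma outcomeS (Sigma : finType) (A : altautomaton Sigma)
    (smax smin : strategy (state A)) n :
  let r := outcome smax smin in
  r n.+1 = if existential (r n) then smax (history r n) (r n)
           else smin (history r n) (r n).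
Proof. by move=> r; rewrite {1}/r /outcome /= play_history. Qed.

(** * Forcing a condition over finitely many letters *)

Section Forcing.
Variables (Sigma : finType) (A : wautomaton Sigma).
Variable d : state A -> Sigma -> state A -> rat.
Implicit Types (P : pred (state A)) (S : state A -> rat -> Prop).
Implicit Types (v u : seq Sigma) (q : state A) (e : rat).

(* The owner of the states in [P] can enforce [S] at the end of [v], for the
   state and for the level, that is, [e] plus the values of [d] met. *)
Fixpoint force P v S q e : Prop :=
  if v is x :: v' then
    if P q then exists2 q', trans q x q' & force P v' S q' (e + d q x q')
    else forall q', trans q x q' -> force P v' S q' (e + d q x q')
  else S q e.

Lemma force_impl P v S S' q e : (forall q' e', S q' e' -> S' q' e') ->
  force P v S q e -> force P v S' q e.
Proof.
move=> SS'; elim: v q e => [|x v IH] q e /=; first exact: SS'.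
case: ifP => _ h; first by have [q' t f] := h; exists q' => //; exact: IH.
by move=> q' t; apply/IH/h.
Qed.

Lemma force_cat P v u S q e :
  force P (v ++ u) S q e <-> force P v (force P u S) q e.
Proof.
elim: v q e => [//|x v IH] q e /=.
by case: ifP => _; split=> h; [have [q' t /IH] := h; exists q'|
  have [q' t /IH] := h; exists q'|move=> q' /h /IH|move=> q' /h /IH].
Qed.

(** Determinacy of a game with finitely many moves: the quantifiers are exchanged letter by
    letter. *)
Lemma forceC P v S q e : ~ force (predC P) v S q e ->
  force P v (fun q' e' => ~ S q' e') q e.
Proof.
elim: v q e => [//|x v IH] q e /=; case: (P q) => /= h; last first.
  by move=> q' t; apply: IH => f; apply: h; exists q'.
apply: contrapT => h'; apply: h => q' t.
by apply: contrapT => f; apply: h'; exists q' => //; exact: IH.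
Qed.

Lemma force_shift P v S q e x :
  force P v S q (e + x) <-> force P v (fun q' e' => S q' (e' + x)) q e.
Proof.
elim: v q e => [//|y v IH] q e /=.
case: ifP => _; split=> h.
- by have [q' t] := h; rewrite addrAC => /IH; exists q'.
- by have [q' t /IH] := h; rewrite addrAC; exists q'.
- by move=> q' /h; rewrite addrAC => /IH.
- by move=> q' /h /IH; rewrite addrAC.
Qed.

Lemma force_bounded P v S q e M :
  (forall q1 x q2, `|d q1 x q2| <= M) -> force P v S q e ->
  force P v (fun q' e' => S q' e' /\ `|e' - e| <= (size v)%:R * M) q e.
Proof.
move=> dM; elim: v q e => [|x v IH] q e /=.
  by rewrite subrr normr0 mul0r.
have aux q' : force P v S q' (e + d q x q') ->
    force P v (fun q1 e1 => S q1 e1 /\ `|e1 - e| <= (size v).+1%:R * M)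
      q' (e + d q x q').
  move=> /IH; apply: force_impl => q1 e1 [Sq he]; split=> //.
  have -> : e1 - e = (e1 - (e + d q x q')) + d q x q' by ring.
  by rewrite -natr1 mulrDl mul1r (le_trans (ler_normD _ _)) // lerD.
case: ifP => _ h; first by have [q' t /aux] := h; exists q'.
by move=> q' /h /aux.
Qed.

Lemma force_down P v S q e e' :
  (forall q1 e1 e2, e2 <= e1 -> S q1 e1 -> S q1 e2) ->
  e' <= e -> force P v S q e -> force P v S q e'.
Proof.
move=> Sd ee'; rewrite -{1}(subrK e' e) addrC => /force_shift.
apply: force_impl => q1 e1; apply: Sd; lra.
Qed.

(* Compactness: transitions being finitely branching, infinitely many of the
   [S n] are enforced by the same choice. *)
Lemma force_bigcap P v (S : nat -> state A -> rat -> Prop) q e :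
  (forall n q1 e1, S n.+1 q1 e1 -> S n q1 e1) ->
  (forall n, force P v (S n) q e) ->
  force P v (fun q1 e1 => forall n, S n q1 e1) q e.
Proof.
move=> Sn; have Smono n m q1 e1 : (n <= m)%N -> S m q1 e1 -> S n q1 e1.
  by move=> /subnK <-; elim: (m - n)%N => // k IH /Sn.
elim: v q e => [//|x v IH] q e /=; case: ifP => _ h; last first.
  by move=> q' t; apply: IH => n; exact: h.
suff [q' t hq'] : exists2 q', trans q x q' &
    forall n, force P v (S n) q' (e + d q x q').
  by exists q' => //; exact: IH.
apply: contrapT => hN.
have /choice[f hf] q' : exists n, trans q x q' ->
    ~ force P v (S n) q' (e + d q x q').
  apply: contrapT => hq'; apply: hN; exists q'.
    by apply: contrapT => t; apply: hq'; exists 0%N => /t.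
  by move=> n; apply: contrapT => hn; apply: hq'; exists n.
have [q' t fq'] := h (\max_q' f q')%N.
apply: (hf q' t); apply: force_impl fq' => q1 e1; apply: Smono.
exact: (leq_bigmax q').
Qed.

(** Recomputes the level from the past and the current state, which are all that a strategy sees. *)
Fixpoint level (w : word Sigma) (h : seq (state A)) (q : state A) : rat :=
  if h is q0 :: h' then level w h' q0 + d q0 (w (size h')) q else 0.

Definition gain (w : word Sigma) (r : nat -> state A) : nat -> rat :=
  psum (fun i => d (r i) (w i) (r i.+1)).

Lemma level_history w r n : level w (history r n) (r n) = gain w r n.
Proof.
elim: n => [|n IH] /=; first by rewrite /gain /psum big_ord0.
by rewrite IH /gain psumS size_history.
Qed.

(** Binds one player only, so either player can own [P] and no opposing strategy has to be named. *)
Definition follows P (s : strategy (state A)) (r : nat -> state A) :=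
  forall n, P (r n) -> r n.+1 = s (history r n) (r n).

(** The strategy picks a successor preserving [I] at the level recomputed from the past, and any
    successor on pasts where [I] fails. *)
Lemma invariant_strategy P (w : word Sigma)
    (I : nat -> state A -> rat -> Prop) :
  (forall n q e, I n q e ->
     if P q then exists2 q', trans q (w n) q' & I n.+1 q' (e + d q (w n) q')
     else forall q', trans q (w n) q' -> I n.+1 q' (e + d q (w n) q')) ->
  I 0%N (init A) 0 ->
  exists2 s : strategy (state A), legal w P s &
    forall r, is_run w r -> follows P s r -> forall n, I n (r n) (gain w r n).
Proof.
move=> Istep I0.
have /choice[s hs] (hq : seq (state A) * state A) : exists q',
    trans hq.2 (w (size hq.1)) q' /\
    (P hq.2 -> I (size hq.1) hq.2 (level w hq.1 hq.2) ->
     I (size hq.1).+1 q' (level w hq.1 hq.2 + d hq.2 (w (size hq.1)) q')).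
  case: hq => h q /=.
  have [q1 t1] := trans_total q (w (size h)).
  have [[Pq Iq]|N] := pselect (P q /\ I (size h) q (level w h q)).
    by have := Istep _ _ _ Iq; rewrite Pq => -[q' t Iq']; exists q'.
  by exists q1; split => // Pq Iq; case: N.
exists (fun h q => s (h, q)) => [h q _|r [r0 rt] rs n].
  by have [] := hs (h, q).
elim: n => [|n IH]; first by rewrite r0 /gain /psum big_ord0.
rewrite /gain psumS; have := Istep _ _ _ IH; case: ifP => [Pr _|_]; last exact.
have [_ /=] := hs (history r n, r n).
by rewrite size_history level_history (rs n Pr); exact.
Qed.

(** Chains finite forcings, one per interval from [p i] to [p i.+1], into one infinite strategy. *)
Lemma phase_strategy P (w : word Sigma) (p : nat -> nat)
    (S : nat -> state A -> rat -> Prop) :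
  p 0%N = 0%N -> (forall i, (p i < p i.+1)%N) -> S 0%N (init A) 0 ->
  (forall i q e, S i q e ->
     force P (mkseq (fun k => w (p i + k)%N) (p i.+1 - p i)) (S i.+1) q e) ->
  exists2 s : strategy (state A), legal w P s &
    forall r, is_run w r -> follows P s r ->
    forall i, S i (r (p i)) (gain w r (p i)).
Proof.
move=> p0 pS S0 Sf.
have pm i j : (i <= j)%N -> (p i <= p j)%N.
  by move/subnK <-; elim: (j - i)%N => // k /leq_trans; apply; exact/ltnW/pS.
(* Within phase [i] the end condition is enforceable over the remaining letters; the middle clause
   recovers [S i] at the phase boundary. *)
pose I n q e := exists i, [/\ (p i <= n < p i.+1)%N, n = p i -> S i q e &
  force P (mkseq (fun k => w (n + k)%N) (p i.+1 - n)) (S i.+1) q e].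
have SI i q e : S i q e -> I (p i) q e.
  by move=> Siq; exists i; split; rewrite ?leqnn ?pS //; exact: Sf.
have [n q e [i [/andP[pin npi] _ fi]]||s sl hs] := @invariant_strategy P w I.
- have nx q' e' :
      force P (mkseq (fun k => w (n.+1 + k)%N) (p i.+1 - n.+1)) (S i.+1)
        q' e' ->
      I n.+1 q' e'.
    move=> f; move: npi; rewrite leq_eqVlt => /orP[/eqP E|npi].
      by move: f; rewrite E subnn => /= /SI.
    exists i; split => //; first by rewrite npi andbT ltnW.
    by move=> E; move: pin; rewrite -E ltnn.
  move: fi; rewrite -(subnSK npi) /mkseq /= addn0 -(addn0 1%N) iotaDl -map_comp.
  rewrite (eq_map (g := fun k => w (n.+1 + k)%N)); last first.
    by move=> k /=; rewrite addnA addn1.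
  case: ifP => _ h; first by have [q' t /nx] := h; exists q'.
  by move=> q' /h /nx.
- by rewrite -p0; exact: SI.
exists s => // r rr rs i; have [j [/andP[pji pij] Sj _]] := hs r rr rs (p i).
have ij : i = j.
  apply/eqP; rewrite eqn_leq; apply/andP; split.
    by rewrite leqNgt; apply/negP => /pm; rewrite leqNgt pij.
  rewrite leqNgt; apply/negP => /pm; rewrite leqNgt => /negP; apply.
  exact: leq_ltn_trans pji (pS i).
by move: Sj; rewrite -ij; exact.
Qed.

End Forcing.

Lemma fin_bound (T : finType) (P : T -> rat -> Prop) :
  (forall t x y, x <= y -> P t x -> P t y) -> (forall t, exists x, P t x) ->
  exists2 x, 0 <= x & forall t, P t x.
Proof.
move=> Pup /choice[f Pf]; exists (\sum_t `|f t|); first exact: sumr_ge0.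
move=> t; apply: Pup (Pf t); apply: le_trans (ler_norm _) _.
by rewrite (bigD1 t) //= lerDl sumr_ge0.
Qed.

(** * Energy games on a repeated finite word *)

Section Energy.
Variables (Sigma : finType) (A : wautomaton Sigma).
Variable d : state A -> Sigma -> state A -> rat.
Variable P : pred (state A).
Implicit Types (u : seq Sigma) (q : state A) (e : rat).

Lemma d_bounded : exists2 M, 0 <= M & forall q x q', `|d q x q'| <= M.
Proof.
have [|t|M M0 hM] := @fin_bound (state A * Sigma * state A)%type
    (fun t m => `|d t.1.1 t.1.2 t.2| <= m).
- by move=> t x y xy /le_trans; exact.
- by exists `|d t.1.1 t.1.2 t.2|.
- by exists M => // q x q'; exact: (hM (q, x, q')).
Qed.

(** An energy condition with finite horizon: the level is kept nonpositive between repetitions of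
    [u], but is free inside them. *)
Fixpoint safe u (n : nat) q e : Prop :=
  if n is m.+1 then e <= 0 /\ force d (predC P) u (safe u m) q e else e <= 0.

Definition always_safe u q e := forall n, safe u n q e.

(* From [q] the minimizer can keep the sum of [d] bounded from above when
   reading [u] repeatedly. *)
Definition boundable u q := exists B, always_safe u q (- B).

Lemma safe_le0 u n q e : safe u n q e -> e <= 0.
Proof. by case: n => [//|n []]. Qed.

Lemma safeS u n q e : safe u n.+1 q e -> safe u n q e.
Proof.
elim: n q e => [|n IH] q e; first by case.
by case=> e0 f; split=> //; apply: force_impl f => q' e'; exact: IH.
Qed.

Lemma safe_leq u n m q e : (n <= m)%N -> safe u m q e -> safe u n q e.
Proof. by move=> /subnK <-; elim: (m - n)%N => // k IH /safeS. Qed.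

Lemma safe_down u n q e e' : e' <= e -> safe u n q e -> safe u n q e'.
Proof.
elim: n q e e' => [|n IH] q e e' ee'; first exact: le_trans.
case=> e0 f; split; first exact: le_trans ee' e0.
by apply: force_down ee' f => q1 e1 e2; exact: IH.
Qed.

Lemma always_safe_down u q e e' :
  e' <= e -> always_safe u q e -> always_safe u q e'.
Proof. by move=> ee' h n; exact: safe_down (h n). Qed.

(** By compactness one way of playing serves all horizons, so safety survives a reading of [u]. *)
Lemma always_safe_force u q e :
  always_safe u q e -> force d (predC P) u (always_safe u) q e.
Proof.
move=> h; apply: force_bigcap => [n q1 e1|n]; first exact: safeS.
by have [] := h n.+1.
Qed.

Lemma always_safe_pow u n q e :
  always_safe u q e -> force d (predC P) (powseq u n) (always_safe u) q e.
Proof.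
elim: n q e => [//|n IH] q e h; rewrite /powseq /=.
apply/force_cat; apply: force_impl (always_safe_force h) => q' e'.
exact: IH.
Qed.

Lemma boundable_level u : exists2 B, 0 <= B &
  forall q, boundable u q -> always_safe u q (- B).
Proof.
apply: fin_bound => [q x y xy h /h|q].
  by apply: always_safe_down; rewrite lerN2.
have [[B hB]|N] := pselect (boundable u q); first by exists B.
by exists 0.
Qed.

(** Play safely from level [- B], then shift. As [B] does not depend on [n] and the play ends in a
    boundable state, such phases can be chained. *)
Lemma boundable_pow u : exists2 B, 0 <= B & forall q n e, boundable u q ->
  force d (predC P) (powseq u n)
    (fun q' e' => boundable u q' /\ e' <= e + B) q e.
Proof.
have [B B0 hB] := boundable_level u; exists B => // q n e bq.
have -> : e = - B + (e + B) by ring.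
apply/force_shift; apply: force_impl (always_safe_pow n (hB _ bq)) => q' e' h.
split; first by exists (- e'); rewrite opprK.
have := safe_le0 (h 0%N); lra.
Qed.

(* Outside [boundable u] the level can be pushed up by [D], in a bounded number
   of repetitions and without entering [boundable u]; then one starts again
   from level [- D]. *)
Lemma not_boundable_strategy x0 u : u != [::] -> ~ boundable u (init A) ->
  exists2 s : strategy (state A), legal (repeat_word x0 u) P s &
  exists C, forall r, is_run (repeat_word x0 u) r -> follows P s r ->
    forall i, C <= gain d (repeat_word x0 u) r (i * size u).
Proof.
move=> u0 nb; have su : (0 < size u)%N by rewrite lt0n size_eq0.
have [B B0 hB] := boundable_level u; have [M M0 dM] := d_bounded.
(* [K] bounds the change of level over one [u]: a level at most [- D] is at most [- B] one
   repetition later. *)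
pose K := (size u)%:R * M; have K0 : 0 <= K by rewrite mulr_ge0.
pose D := B + K.
have [T hT] : exists T, forall q, ~ boundable u q -> ~ safe u T q (- D).
  have /choice[f hf] q : exists n, ~ boundable u q -> ~ safe u n q (- D).
    have [bq|nbq] := pselect (boundable u q); first by exists 0%N.
    apply: contrapT => h; apply: nbq; exists D => n.
    by apply: contrapT => hn; apply: h; exists n.
  exists (\max_q f q)%N => q /hf; apply: contra_not; apply: safe_leq.
  exact: leq_bigmax.
(* [e] is a virtual level, at least [D] below the true gain [g], from which the minimizer cannot
   stay safe for [j] more repetitions. It loses at most [K] per repetition, hence has a fixed lower
   bound. *)
pose S (i : nat) q g := exists e j, [/\ (j <= T)%N, e + D <= g,
  - D - (T - j)%:R * K <= e, e <= - D & ~ safe u j q e].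
have [|i|||s sl hs] := @phase_strategy _ A d P (repeat_word x0 u)
    (fun i => i * size u)%N S.
- by [].
- by rewrite ltn_mul2r su ltnSn.
- exists (- D), T; split=> //; last exact: hT; first lra.
  by rewrite subnn mul0r subr0.
- move=> i q g [e [[|j] [jT eg eT eD nj]]].
    (* With no repetition left, safety only asks for [e <= 0], which holds. *)
    by case: nj; rewrite /=; apply: le_trans eD _; rewrite /D; lra.
  have e0 : e <= 0 by apply: le_trans eD _; rewrite /D; lra.
  have {}nj : ~ force d (predC P) u (safe u j) q e by move=> f; exact: nj.
  have -> : mkseq (fun k => repeat_word x0 u (i * size u + k)%N)
      (i.+1 * size u - i * size u) = u.
    rewrite mulSn addnK; apply: (@eq_from_nth _ x0); rewrite size_mkseq //.
    move=> k ku.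
    by rewrite nth_mkseq // repeat_word_block.
  have := force_bounded dM (forceC nj); rewrite -/K.
  rewrite (_ : g = e + (g - e)); last by ring.
  move=> f; apply/force_shift; apply: force_impl f => q' e' [nq'].
  rewrite ler_norml => /andP[le1 le2].
  have TK : (T - j)%:R * K = (T - j.+1)%:R * K + K.
    by rewrite -(subnSK jT) -natr1 mulrDl mul1r.
  (* Either the virtual level is still low and the countdown goes on, or it is reset to [- D] with
     horizon [T]. *)
  have [e'D|e'D] := leP e' (- D).
    by exists e', j; split=> //; [exact: ltnW|lra|lra].
  exists (- D), T; split=> //; first lra.
    by rewrite subnn mul0r subr0.
  apply: hT => bq'; apply: nq'; apply: safe_down (hB _ bq' j).
  by move: eD le2; rewrite /D; lra.
- exists s => //; exists (- T%:R * K) => r rr rs i.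
  have [e [j [jT eg eT eD _]]] := hs r rr rs i.
  have : (T - j)%:R * K <= T%:R * K by rewrite ler_wpM2r // ler_nat leq_subr.
  lra.
Qed.

End Energy.

(** * Expressions beyond alternating automata *)

Definition sgn (b : bool) : rat := if b then 1 else -1.

(** For positive [k], the average sign is -1/2 over a block, but 1 over its run of [true]. *)
Definition blocks (k : nat) : seq bool := nseq k true ++ nseq (3 * k) false.

(** * Infinite words as limits of growing prefixes *)

Section Concatenation.
Variables (T : Type) (x0 : T) (f : seq T -> seq T).
Hypothesis f_nonempty : forall v, (0 < size (f v))%N.

Definition prefixes (i : nat) : seq T := iter i (fun v => v ++ f v) [::].

(** [prefixes n.+1] has more than [n] letters, so the default [x0] is never reached. *)
Definition limit_word (n : nat) : T := nth x0 (prefixes n.+1) n.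

Lemma size_prefixesS i : (size (prefixes i) < size (prefixes i.+1))%N.
Proof. by rewrite /= size_cat -ltn_subLR // subnn. Qed.

Lemma leq_size_prefixes i : (i <= size (prefixes i))%N.
Proof. by elim: i => // i IH; apply: leq_ltn_trans IH (size_prefixesS i). Qed.

Lemma nth_prefixes i j n : (i <= j)%N -> (n < size (prefixes i))%N ->
  nth x0 (prefixes j) n = nth x0 (prefixes i) n.
Proof.
move=> /subnK <-; elim: (j - i)%N => [//|k IH] ni.
rewrite addSn /= nth_cat ifT ?IH //.
elim: k {IH} => // k IH; exact: ltn_trans IH (size_prefixesS _).
Qed.

Lemma limit_wordE i n : (n < size (prefixes i))%N ->
  limit_word n = nth x0 (prefixes i) n.
Proof.
move=> ni; have nn := leq_size_prefixes n.+1.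
rewrite /limit_word.
by have [/nth_prefixes ->|/ltnW/nth_prefixes ->] := leqP i n.+1.
Qed.

Lemma mkseq_limit_word i :
  mkseq (fun k => limit_word (size (prefixes i) + k)%N)
    (size (prefixes i.+1) - size (prefixes i)) = f (prefixes i).
Proof.
have E : (size (prefixes i.+1) - size (prefixes i) = size (f (prefixes i)))%N.
  by rewrite /= size_cat addKn.
apply: (@eq_from_nth _ x0) => [|k]; rewrite size_mkseq E // => kf.
rewrite nth_mkseq // (@limit_wordE i.+1) /=.
  by rewrite nth_cat ltnNge leq_addr /= addKn.
by rewrite size_cat ltn_add2l.
Qed.

End Concatenation.

(** Infinite pigeonhole principle. *)
Lemma infinitely_often_constant (T : finType) (F : nat -> T) :
  exists Z, forall K, exists2 k, (K <= k)%N & F k = Z.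
Proof.
apply: contrapT => h.
have /choice[g hg] Z : exists K, forall k, (K <= k)%N -> F k <> Z.
  apply: contrapT => hZ; apply: h; exists Z => K; apply: contrapT => hK.
  by apply: hZ; exists K => k Kk Fk; apply: hK; exists k.
by apply: (hg (F (\max_Z g Z)%N) (\max_Z g Z)%N) => //; exact: leq_bigmax.
Qed.

(* The minimizer can use the same set of boundable states for infinitely many
   [blocks k]. Repeating each of these many times before passing to a much
   larger one keeps its gain small, while just after a run of [true] the
   average of the word is large. *)
Lemma oscillating_word (A : wautomaton bool) d (P : pred (state A))
    (eps : rat) :
  0 < eps -> (forall k, (0 < k)%N -> boundable d P (blocks k) (init A)) ->
  exists w : word bool,
    (forall N, exists2 n, (N <= n)%N &
       1 / 2 * n%:R <= psum (fun i => sgn (w i)) n) /\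
    exists2 s : strategy (state A), legal w (predC P) s &
      forall r, is_run w r -> follows (predC P) s r ->
      forall N, exists2 n, (N <= n)%N & gain d w r n <= eps * n%:R.
Proof.
move=> eps0 hb.
(* A set of states is encoded as a finite function, so as to live in a finite type. *)
have [Z hZ] := @infinitely_often_constant {ffun state A -> bool}
  (fun k => [ffun q => `[< boundable d P (blocks k) q >]]).
have inZ : Z (init A).
  by have [k k0 <-] := hZ 1%N; rewrite ffunE; apply/asboolP; exact: hb.
pose S (n : nat) q (e : rat) := Z q /\ e <= eps * n%:R.
have /choice[f hf] (v : seq bool) : exists y, exists k y', [/\ (0 < k)%N,
    (3 * size v <= k)%N, y = nseq k true ++ y' & forall q e, S (size v) q e ->
    force d (predC P) y (S (size (v ++ y))) q e].
  (* If [k] is at least three times the length s already written, the average after [k] letters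
     [true] is at least (k - s) / (k + s), hence at least 1/2. *)
  have [k kv Zk] := hZ (3 * size v).+1.
  have k0 : (0 < k)%N by apply: leq_trans kv.
  have [B B0 hB] := boundable_pow d P (blocks k).
  (* Enough repetitions for the allowance [eps] per letter to pay for [B]. *)
  pose t := (Num.bound (B / eps)).+1.
  have ht : B <= eps * t%:R.
    rewrite mulrC -ler_pdivrMr // ltW // /t -natr1.
    by rewrite ltr_wpDr // archi_boundP // divr_ge0 // ltW.
  exists (powseq (blocks k) t), k,
    (nseq (3 * k) false ++ powseq (blocks k) t.-1).
  split => //; first exact: ltnW.
    by rewrite catA.
  move=> q e [qZ ev]; have /hB : boundable d P (blocks k) q.
    by move: qZ; rewrite -Zk ffunE => /asboolP.
  move=> /(_ t e); apply: force_impl => q' e' [bq' e'B]; split.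
    by rewrite -Zk ffunE; apply/asboolP.
  rewrite size_cat size_powseq natrD mulrDr; apply: le_trans e'B _.
  rewrite lerD //; apply: le_trans ht _.
  rewrite ler_wpM2l ?(ltW eps0) // ler_nat.
  by rewrite leq_pmulr // size_cat size_nseq addn_gt0 k0.
have f0 v : (0 < size (f v))%N.
  have [k [y [k0 _ -> _]]] := hf v.
  by rewrite size_cat size_nseq addn_gt0 k0.
pose w := limit_word true f; exists w; split.
  move=> N; have [k [y [k0 kN fE _]]] := hf (prefixes f N).
  have sN := leq_size_prefixes f0 N.
  exists (size (prefixes f N) + k)%N; first exact: leq_trans sN (leq_addr _ _).
  rewrite psumD.
  have -> : psum (fun i => sgn (w (size (prefixes f N) + i)%N)) k = k%:R.
    rewrite /psum (eq_bigr (fun=> 1)) ?sumr_const ?card_ord // => i _.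
    rewrite /w (@limit_wordE _ _ _ f0 N.+1) /=; last first.
      by rewrite size_cat ltn_add2l fE size_cat size_nseq ltn_addr.
    rewrite nth_cat ltnNge leq_addr /= addKn fE nth_cat size_nseq ltn_ord.
    by rewrite nth_nseq ltn_ord.
  have : - (size (prefixes f N))%:R <=
      psum (fun i => sgn (w i)) (size (prefixes f N)).
    rewrite -mulrN1; apply: psum_ge => i; rewrite /sgn; case: ifP => _; lra.
  have : (3 * size (prefixes f N))%:R <= k%:R :> rat by rewrite ler_nat.
  rewrite natrM natrD; lra.
have [//|i|||s sl hs] := @phase_strategy _ A d (predC P) w
    (fun i => size (prefixes f i)) (fun i => S (size (prefixes f i))).
- exact: size_prefixesS.
- by split=> //; rewrite mulr0.
- move=> i q e Sqe; rewrite mkseq_limit_word //.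
  by have [k [y [_ _ _ h]]] := hf (prefixes f i); exact: h.
exists s => // r rr rs N; exists (size (prefixes f N)).
  exact: leq_size_prefixes.
by have [] := hs r rr rs N.
Qed.

(** The thresholds lie strictly between -1 and -1/2, which bound the value from above on the block
    words and from below on the oscillating word. [P] is left abstract to serve both value
    functions. *)
Lemma game_gap (A : wautomaton bool) (P : pred (state A)) :
  (forall k, (0 < k)%N -> let w := repeat_word true (blocks k) in
    ~ exists2 s : strategy (state A), legal w P s &
      forall r, is_run w r -> follows P s r ->
      exists C, forall n, - (3 / 4) * n%:R + C <= psum (run_weights w r) n) ->
  exists w : word bool,
    (forall N, exists2 n, (N <= n)%N &
       1 / 2 * n%:R <= psum (fun i => sgn (w i)) n) /\
    exists2 s : strategy (state A), legal w (predC P) s &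
      forall r, is_run w r -> follows (predC P) s r ->
      forall N, exists2 n, (N <= n)%N &
        psum (run_weights w r) n <= - (5 / 8) * n%:R.
Proof.
move=> noP; pose d (q : state A) x q' := wt q x q' + 3 / 4.
have dE w r n : gain d w r n = psum (run_weights w r) n + 3 / 4 * n%:R.
  rewrite /gain /psum /d big_split /= sumr_const card_ord.
  by rewrite -[X in _ + X]mulr_natr.
(* The slack 1/8 turns -3/4 into -5/8. *)
have [//|k k0|w [hw [s sl hs]]] := @oscillating_word A d P (1 / 8).
  apply: contrapT => nb; apply: (noP k k0).
  have u0 : blocks k != [::] by rewrite -size_eq0 size_cat size_nseq; lia.
  have [s sl [C hC]] := not_boundable_strategy true u0 nb.
  exists s => // r rr rs.
  have [M M0 dM] := d_bounded d.
  have su : (0 < size (blocks k))%N by rewrite lt0n size_eq0.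
  pose w := repeat_word true (blocks k).
  have vM i : `|d (r i) (w i) (r i.+1)| <= M by exact: dM.
  have hj j : j%:R * 0 + C <= gain d w r (j * size (blocks k)).
    by rewrite mulr0 add0r; exact: hC.
  have [C' hC'] := psum_block_ge su vM hj.
  exists C' => n; have := hC' n; rewrite mul0r mul0r add0r -/(gain d w r n) dE.
  rewrite -/w; lra.
exists w; split=> //; exists s => // r rr rs N.
have [n Nn] := hs r rr rs N; rewrite dE => hn; exists n => //; lra.
Qed.

Definition sign_automaton : wautomaton bool :=
  @WAutomaton bool unit tt (fun _ _ _ => true)
    (fun _ _ => ex_intro _ tt erefl) (fun _ x _ => sgn x).

Lemma sign_automaton_det : deterministic sign_automaton.
Proof. by move=> q a; exists tt; split=> // -[]. Qed.

Definition sign_expr : mpexpr bool :=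
  ESum (EAut LimInfAvg sign_automaton_det) (EAut LimSupAvg sign_automaton_det).

(** Its runs on [w] are those of [A] on [negb \o w], with opposite weights. The players are
    exchanged separately, through the choice of [P]. *)
Definition dual_automaton (A : wautomaton bool) : wautomaton bool :=
  @WAutomaton bool (state A) (init A) (fun q x => trans q (~~ x))
    (fun q x => trans_total q (~~ x)) (fun q x q' => - wt q (~~ x) q').

Lemma outcome_run (Sigma : finType) (A : altautomaton Sigma) (w : word Sigma)
    (smax smin : strategy (state A)) :
  legal w (@existential _ A) smax -> legal w (predC (@existential _ A)) smin ->
  is_run w (outcome smax smin).
Proof.
move=> lmax lmin; split=> // n; rewrite outcomeS.
case: ifPn => ex; first by have := lmax (history (outcome smax smin) n) _ ex;
  rewrite size_history.
by have := lmin (history (outcome smax smin) n) _ ex; rewrite size_history.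
Qed.

(** * The sum of both limit averages of the signs *)

Section Sign.
Variable R : realType.

Lemma sign_automatonE f (w : word bool) :
  nondet_value R f sign_automaton w = Val R f (fun i => sgn (w i)).
Proof.
rewrite /nondet_value; have -> : [set Val R f (run_weights w r) | r in
    is_run (A := sign_automaton) w] = [set Val R f (fun i => sgn (w i))].
  by apply/seteqP; split=> [_ [r _ <-]//|_ ->]; exists (fun=> tt).
exact: ereal_sup1.
Qed.

Lemma Val_sgn f (w : word bool) :
  ((-1)%:E <= Val R f (fun i => sgn (w i)) <= 1%:E)%E.
Proof.
have s1 i : -1 <= sgn (w i) <= 1 by rewrite /sgn; case: (w i).
have -> : (-1)%:E = (ratr (-1))%:E :> \bar R by rewrite rmorphN1.
have -> : 1%:E = (ratr 1)%:E :> \bar R by rewrite rmorph1.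
apply/andP; split.
  apply: (@Val_ge _ _ _ _ 0) => n; rewrite addr0 mulrC.
  by apply: psum_ge => i; have /andP[] := s1 i.
apply: (@Val_le _ _ _ _ 0) => n; rewrite addr0 mulrC.
by apply: psum_le => i; have /andP[] := s1 i.
Qed.

Lemma Val_sgnE f (w : word bool) : exists2 x : R,
  Val R f (fun i => sgn (w i)) = x%:E & -1 <= x <= 1.
Proof.
have := Val_sgn f w; case: (Val _ _ _) => [x| |].
- by rewrite !lee_fin; exists x.
- by rewrite leye_eq andbF.
- by rewrite leeNy_eq.
Qed.

Lemma sign_exprE (w : word bool) :
  expr_value R sign_expr w = (Val R LimInfAvg (fun i => sgn (w i)) +
                              Val R LimSupAvg (fun i => sgn (w i)))%E.
Proof. by rewrite /= !sign_automatonE. Qed.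

Definition sign_lang : qlang R bool := fun w => fine (expr_value R sign_expr w).

Lemma sign_langE w : expr_value R sign_expr w = (sign_lang w)%:E.
Proof.
rewrite fineK // sign_exprE.
by have [x -> _] := Val_sgnE LimInfAvg w; have [y -> _] := Val_sgnE LimSupAvg w.
Qed.

Lemma sgn_negb (w : word bool) :
  (fun i => sgn ((negb \o w) i)) = (fun i => - sgn (w i)).
Proof. by apply/funext => i /=; case: (w i); rewrite /sgn /= ?opprK. Qed.

(** A period of 4k letters weighs -2k, so each limit average is at most -1/2. *)
Lemma sign_lang_blocks k (w := repeat_word true (blocks k)) : (0 < k)%N ->
  sign_lang w <= -1 /\ 1 <= sign_lang (negb \o w).
Proof.
move=> k0; have sb : size (blocks k) = (k + 3 * k)%N.
  by rewrite size_cat !size_nseq.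
have hp j : psum (fun i => sgn (w i)) (j * size (blocks k)) <=
    j%:R * (- (2 * k%:R)) + 0.
  rewrite psum_repeat_word big_cat !big_nseq /= !iter_addr !addr0.
  by rewrite mulNrn natrM (_ : k%:R - _ = - (2 * k%:R)) //; ring.
have [||C hC] := psum_block_le (M := 1) _ _ hp.
- by rewrite sb; lia.
- by move=> i; rewrite /sgn; case: (w i); rewrite ?normrN normr1.
have {}hC n : psum (fun i => sgn (w i)) n <= - (1 / 2) * n%:R + C.
  suff -> : - (1 / 2) = (- (2 * k%:R) / (size (blocks k))%:R) :> rat by [].
  have kp : 0 < k%:R :> rat by rewrite ltr0n.
  by rewrite sb natrD natrM; field; apply: lt0r_neq0; lra.
have c : ratr (1 / 2) = 1 / 2 :> R.
  by rewrite rmorphM fmorphV rmorph1 !rmorph_nat.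
rewrite -!lee_fin -!sign_langE !sign_exprE; split.
  have cN : ratr (- (1 / 2)) = - (1 / 2) :> R by rewrite raddfN /= c.
  have le f := @Val_le R f _ _ _ hC; rewrite cN in le.
  by apply: le_trans (leeD (le _) (le _)) _; rewrite -EFinD lee_fin; lra.
have ge f : ((1 / 2)%:E <= Val R f (fun i => sgn ((negb \o w) i)))%E.
  rewrite -c sgn_negb; apply: (@Val_ge _ _ _ _ (- C)) => n.
  by rewrite psumN; have := hC n; lra.
by apply: le_trans (leeD (ge _) (ge _)); rewrite -EFinD lee_fin; lra.
Qed.

(** The limit superior is at least 1/2 and the limit inferior of signs at least -1; negation is
    symmetric. *)
Lemma sign_lang_oscillating (w : word bool) :
  (forall N, exists2 n, (N <= n)%N &
     1 / 2 * n%:R <= psum (fun i => sgn (w i)) n) ->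
  - (1 / 2) <= sign_lang w /\ sign_lang (negb \o w) <= 1 / 2.
Proof.
move=> h; rewrite -!lee_fin -!sign_langE !sign_exprE; split.
  have [x xE /andP[x1 _]] := Val_sgnE LimInfAvg w; rewrite xE.
  have := @Val_LimSup_ge R _ _ h.
  have [y -> _] := Val_sgnE LimSupAvg w; rewrite -EFinD !lee_fin.
  rewrite rmorphM fmorphV !rmorph_nat; lra.
have [x xE /andP[_ x1]] := Val_sgnE LimSupAvg (negb \o w); rewrite xE.
have [y yE _] := Val_sgnE LimInfAvg (negb \o w).
have : (y%:E <= (ratr (- (1 / 2)))%:E :> \bar R)%E.
  rewrite -yE; apply: Val_LimInf_le => N; have [n Nn hn] := h N; exists n => //.
  by rewrite sgn_negb psumN mulNr lerN2.
rewrite yE -EFinD !lee_fin rmorphN rmorphM fmorphV rmorph1 !rmorph_nat; lra.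
Qed.

Lemma sign_lang_not_alt : ~ alt_expressible sign_lang.
Proof.
case=> -[] [A hA].
- have [k k0 w [s sl hs]|w [/sign_lang_oscillating[osc _] [s sl hs]]] :=
    @game_gap A (@existential _ A).
    have [Lw _] := sign_lang_blocks k0.
    suff : ((ratr (- (3 / 4)))%:E <= (sign_lang w)%:E :> \bar R)%E.
      rewrite lee_fin rmorphN rmorphM fmorphV !rmorph_nat; lra.
    rewrite -hA; apply: le_trans (ereal_sup_ubound _); last by exists s.
    apply: le_ereal_inf_tmp => _ [t tl <-].
    have [||C hC] := hs (outcome s t); first exact: outcome_run.
      by move=> n ex; rewrite outcomeS ex.
    exact: Val_ge hC.
  suff : ((sign_lang w)%:E <= (ratr (- (5 / 8)))%:E :> \bar R)%E.
    rewrite lee_fin rmorphN rmorphM fmorphV !rmorph_nat; lra.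
  rewrite -hA; apply: ge_ereal_sup => _ [t tl <-].
  apply: le_trans (_ : Val R LimInfAvg (run_weights w (outcome t s)) <= _)%E.
    by apply: ereal_inf_lbound; exists s.
  apply: Val_LimInf_le; apply: hs; first exact: outcome_run.
  by move=> n ex; rewrite outcomeS ifN.
(* For [LimSupAvg], the minimizer of [A] becomes the maximizer of the dual automaton. *)
- have [k k0 w [s sl hs]|w [/sign_lang_oscillating[_ osc] [s sl hs]]] :=
    @game_gap (dual_automaton A) (predC (@existential _ A)).
    have [_ Lw] := sign_lang_blocks k0.
    suff : ((sign_lang (negb \o w))%:E <= (ratr (3 / 4))%:E :> \bar R)%E.
      rewrite lee_fin rmorphM fmorphV !rmorph_nat; lra.
    rewrite -hA; apply: ge_ereal_sup => _ [t tl <-].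
    apply: le_trans
      (_ : Val R LimSupAvg (run_weights (negb \o w) (outcome t s)) <= _)%E.
      by apply: ereal_inf_lbound; exists s.
    have [||C hC] := hs (outcome t s).
    + exact: (@outcome_run _ A (negb \o w)).
    + by move=> n ex; rewrite outcomeS ifN.
    apply: (@Val_le _ _ _ _ (- C)) => n.
    have := hC n; rewrite -lerN2 -psumN.
    have -> :
        (fun i => - run_weights (A := dual_automaton A) w (outcome t s) i) =
        run_weights (negb \o w) (outcome t s).
      by apply/funext => i; rewrite /run_weights /= opprK.
    lra.
  suff : ((ratr (5 / 8))%:E <= (sign_lang (negb \o w))%:E :> \bar R)%E.
    rewrite lee_fin rmorphM fmorphV !rmorph_nat; lra.
  have {}sl : legal (negb \o w) (@existential _ A) s.
    by move=> h q ex; apply: sl; rewrite /= ex.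
  rewrite -hA; apply: le_trans (ereal_sup_ubound _); last by exists s.
  apply: le_ereal_inf_tmp => _ [t tl <-].
  apply: Val_LimSup_ge => N.
  have [||n Nn hn] := hs (outcome s t) _ _ N.
  + exact: (@outcome_run _ A (negb \o w)).
  + by move=> n /negPn ex; rewrite outcomeS ex.
  exists n => //; move: hn; rewrite -lerN2 -psumN.
  have -> : (fun i => - run_weights (A := dual_automaton A) w (outcome s t) i) =
      run_weights (negb \o w) (outcome s t).
    by apply/funext => i; rewrite /run_weights /= opprK.
  lra.
Qed.

End Sign.

(** * Nondeterministic automata beyond expressions *)

(** Preperiod and period of an orbit are at most [n]: the period divides the factorial, and that
    many steps lead past the preperiod. *)
Lemma iter_fact (T : finType) (g : T -> T) (n : nat) (x : T) : (#|T| <= n)%N ->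
  iter n`! g (iter n`! g x) = iter n`! g x.
Proof.
move=> Tn.
have /injectivePn[i [j ij gij]] :
    ~~ injectiveb (fun i : 'I_#|T|.+1 => iter i g x).
  by apply/negP => /injectiveP/leq_card; rewrite card_ord ltnn.
wlog lij : i j ij gij / (i < j)%N.
  move=> h; case: (ltngtP i j) => [|ji|/val_inj ij']; first exact: h gij.
    by apply: (h j i) => //; rewrite eq_sym.
  by rewrite ij' eqxx in ij.
have per1 m : (i <= m)%N -> iter ((j - i) + m) g x = iter m g x.
  move=> im; have -> : ((j - i) + m = (m - i) + j)%N by lia.
  by rewrite iterD -gij -iterD subnK.
have per k m : (i <= m)%N -> iter (k * (j - i) + m) g x = iter m g x.
  elim: k => [//|k IH] im; rewrite mulSn -addnA per1 ?IH //.
  exact: leq_trans im (leq_addl _ _).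
have ji0 : (0 < j - i)%N by rewrite subn_gt0.
have jn : (j <= n)%N by rewrite (leq_trans _ Tn) // -ltnS.
have /dvdnP[k kE] : (j - i %| n`!)%N by rewrite dvdn_fact // ji0; lia.
have nn : (n <= n`!)%N.
  by case: (n) => // m; rewrite factS leq_pmulr // fact_gt0.
by rewrite -iterD {1}kE per //; lia.
Qed.

Lemma last_powseq_None (T : Type) (u : seq (option T)) n :
  last None u = None -> last None (powseq u n) = None.
Proof. by move=> uN; elim: n => //= n IH; rewrite /powseq /= last_cat uN. Qed.

Lemma powseqD (T : Type) (u : seq T) m n :
  powseq u (m + n) = powseq u m ++ powseq u n.
Proof. by rewrite /powseq nseqD flatten_cat. Qed.

Lemma count_powseq (T : Type) (p : pred T) (u : seq T) n :
  count p (powseq u n) = (n * count p u)%N.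
Proof. by elim: n => //= n IH; rewrite /powseq /= count_cat IH mulSn. Qed.

Lemma repeat_word_powseq (Sigma : finType) (x0 : Sigma) u m : (0 < m)%N ->
  repeat_word x0 (powseq u m) = repeat_word x0 u.
Proof.
move=> m0; have [->|u0] := eqVneq u [::].
  apply/funext => n.
  by rewrite /repeat_word !nth_default ?size_powseq //= muln0.
have su : (0 < size u)%N by rewrite lt0n size_eq0.
have E k n : (k < n * size u)%N ->
    nth x0 (powseq u n) k = nth x0 u (k %% size u).
  elim: n k => [//|n IH] k kn; rewrite /powseq /= nth_cat.
  case: ltnP => ku; first by rewrite modn_small.
  by rewrite IH ?ltn_subLR -?mulSn // -{2}(subnK ku) modnDr.
apply/funext => n; rewrite /repeat_word E size_powseq ?ltn_mod ?muln_gt0 ?m0 //.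
by rewrite modn_dvdm // dvdn_mull.
Qed.

Lemma psum_count (T : eqType) (x0 c : T) (s : seq T) :
  psum (fun k => (nth x0 s k == c)%:R) (size s) = (count_mem c s)%:R.
Proof.
rewrite /psum -sum1_count natr_sum (big_nth x0) big_mkord [RHS]big_mkcond /=.
by apply: eq_bigr => i _; case: eqP.
Qed.

(** * Runs and weights of deterministic automata *)

Section Deterministic_runs.
Variables (Sigma : finType) (A : wautomaton Sigma).
Variable next : state A -> Sigma -> state A.
Hypothesis nextP : forall q x q', trans q x q' <-> q' = next q x.

Fixpoint det_run (w : word Sigma) (n : nat) : state A :=
  if n is m.+1 then next (det_run w m) (w m) else init A.

Lemma det_value (R : realType) f (w : word Sigma) :
  nondet_value R f A w = Val R f (run_weights w (det_run w)).
Proof.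
rewrite /nondet_value.
have -> : [set Val R f (run_weights w r) | r in is_run (A := A) w] =
    [set Val R f (run_weights w (det_run w))].
  apply/seteqP; split=> [_ [r [r0 rt] <-]|_ ->].
    congr (Val R f (run_weights w _)); apply/funext; elim=> [//|n IH].
    by have /nextP -> := rt n; rewrite IH.
  by exists (det_run w) => //; split=> // n; apply/nextP.
exact: ereal_sup1.
Qed.

Definition dest q (v : seq Sigma) : state A := foldl next q v.

Fixpoint weight q (v : seq Sigma) : rat :=
  if v is x :: v' then wt q x (next q x) + weight (next q x) v' else 0.

Lemma weight_cat q v v' :
  weight q (v ++ v') = weight q v + weight (dest q v) v'.
Proof. by elim: v q => [|x v IH] q /=; rewrite ?add0r // IH addrA. Qed.

Lemma dest_cat q v v' : dest q (v ++ v') = dest (dest q v) v'.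
Proof. exact: foldl_cat. Qed.

Lemma dest_powseq q v n : dest q (powseq v n) = iter n (dest^~ v) q.
Proof.
elim: n q => [//|n IH] q.
by rewrite [powseq _ _]/(v ++ powseq v n) dest_cat IH -iterSr.
Qed.

Lemma weight_powseq q v n :
  weight q (powseq v n) = \sum_(i < n) weight (iter i (dest^~ v) q) v.
Proof.
elim: n => [|n IH]; first by rewrite big_ord0.
by rewrite -addn1 powseqD weight_cat IH addn1 big_ord_recr /= dest_powseq
  /powseq /= cats0.
Qed.

Lemma det_run_factor x0 (w : word Sigma) n v :
  (forall k, (k < size v)%N -> w (n + k)%N = nth x0 v k) ->
  det_run w (n + size v) = dest (det_run w n) v /\
  psum (run_weights w (det_run w)) (n + size v) =
    psum (run_weights w (det_run w)) n + weight (det_run w n) v.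
Proof.
elim: v n => [|x v IH] n h; first by rewrite addn0 addr0.
have wn : w n = x by have := h 0%N; rewrite addn0; exact.
have [|E1 E2] := IH n.+1.
  by move=> k kv; rewrite addSnnS; exact: (h k.+1).
rewrite /= -addSnnS E1 E2 psumS /= wn; split => //.
by rewrite {2}/run_weights /= wn addrA.
Qed.

Lemma det_run_repeat x0 u j :
  let w := repeat_word x0 u in
  det_run w (j * size u) = iter j (dest^~ u) (init A) /\
  psum (run_weights w (det_run w)) (j * size u) =
    \sum_(i < j) weight (iter i (dest^~ u) (init A)) u.
Proof.
move=> w; elim: j => [|j [E1 E2]]; first by rewrite /psum !big_ord0.
have [k ku|] := @det_run_factor x0 w (j * size u) u.
  exact: repeat_word_block.
by rewrite mulSn addnC E1 E2 big_ord_recr.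
Qed.

(** After the first [u] the state between repetitions is fixed, so later periods all weigh the same
    and the first one only adds a constant. *)
Lemma det_value_repeat (R : realType) f x0 u : u != [::] ->
  (forall q, dest (dest q u) u = dest q u) ->
  nondet_value R f A (repeat_word x0 u) =
  (ratr (weight (dest (init A) u) u / (size u)%:R))%:E.
Proof.
move=> u0 idem; have su : (0 < size u)%N by rewrite lt0n size_eq0.
set W := weight _ _; pose w := repeat_word x0 u.
have iterE i : iter i.+1 (dest^~ u) (init A) = dest (init A) u.
  by elim: i => [//|i IH]; rewrite iterS IH.
have E j : psum (run_weights w (det_run w)) (j.+1 * size u) =
    j.+1%:R * W + (weight (init A) u - W).
  have [_ ->] := det_run_repeat x0 u j.+1.
  rewrite big_ord_recl (eq_bigr (fun=> W)) => [|i _]; last by rewrite iterE.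
  by rewrite sumr_const card_ord -[W *+ j]mulr_natl -natr1 /=; ring.
have [M M0 hM] := d_bounded (@wt _ A).
have wM i : `|run_weights w (det_run w) i| <= M by exact: hM.
have p0 : psum (run_weights w (det_run w)) (0 * size u) = 0.
  by rewrite /psum big_ord0.
(* The absolute value also covers the empty prefix, where [E] does not apply. *)
have [|C1 h1] := psum_block_le su wM (W := W) (C := `|weight (init A) u - W|).
  by case=> [|j]; rewrite ?p0 ?mul0r ?add0r ?normr_ge0 // E lerD2l ler_norm.
have [|C2 h2] := psum_block_ge su wM (W := W) (C := - `|weight (init A) u - W|).
  case=> [|j]; rewrite ?p0 ?mul0r ?add0r ?oppr_le0 ?normr_ge0 // E lerD2l.
  by rewrite lerNl -normrN ler_norm.
by rewrite det_value; apply/le_anti; rewrite (Val_le _ _ h1) (Val_ge _ _ h2).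
Qed.

End Deterministic_runs.

Lemma deterministic_next (Sigma : finType) (A : wautomaton Sigma) :
  deterministic A -> exists next : state A -> Sigma -> state A,
    forall q x q', trans q x q' <-> q' = next q x.
Proof.
move=> detA; have /choice[g hg] (qx : state A * Sigma) : exists q1,
    forall q', trans qx.1 qx.2 q' <-> q' = q1.
  have [q1 [t u]] := detA qx.1 qx.2; exists q1 => q'.
  by split=> [/u ->|->].
by exists (fun q x => g (q, x)) => q x q'; exact: (hg (q, x)).
Qed.

(** * Words that deterministic automata confuse *)

Section Blocks.
Variables (Sigma : finType) (a b c : Sigma).

Definition block (N i j : nat) : seq Sigma :=
  powseq (nseq N a) i ++ powseq (nseq N b) j ++ [:: c].

Definition mixed_word (N : nat) : seq Sigma :=
  powseq (block N 3 1) N ++ powseq (block N 1 3) N.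

Definition uniform_word (N : nat) : seq Sigma :=
  powseq (block N 2 2) (N + N).

Lemma size_block N i j : size (block N i j) = ((i + j) * N).+1.
Proof. by rewrite !size_cat !size_powseq !size_nseq /= addn1 addnS mulnDl. Qed.

Lemma size_mixed_word N : size (mixed_word N) = ((N + N) * (4 * N).+1)%N.
Proof. by rewrite size_cat !size_powseq !size_block [RHS]mulnDl. Qed.

Lemma size_uniform_word N : size (uniform_word N) = ((N + N) * (4 * N).+1)%N.
Proof. by rewrite size_powseq size_block. Qed.

Section Deterministic_blind.
Variables (A : wautomaton Sigma) (next : state A -> Sigma -> state A).
Variable n : nat.
Hypothesis n_large : (#|state A| <= n)%N.
Local Notation dest := (dest next).
Local Notation weight := (weight next).
Local Notation N := n`!.

(** Reading the first copy is idempotent on states, by [iter_fact]. *)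
Lemma dest_run q x i :
  dest q (powseq (nseq N x) i.+1) = dest q (nseq N x).
Proof.
have dE q' : dest q' (nseq N x) = iter N (next^~ x) q'.
  by elim: (N) q' => // m IH q'; rewrite iterSr -IH.
by rewrite dest_powseq; elim: i => [//|i IH]; rewrite iterS IH !dE iter_fact.
Qed.

(** All copies after the first start from the same state, so the weight is affine in their
    number. *)
Lemma weight_run q x i : weight q (powseq (nseq N x) i.+1) =
  weight q (nseq N x) + i%:R * weight (dest q (nseq N x)) (nseq N x).
Proof.
rewrite weight_powseq big_ord_recl /=.
rewrite (eq_bigr (fun=> weight (dest q (nseq N x)) (nseq N x))).
  by rewrite sumr_const card_ord mulr_natl.
move=> k _; rewrite -[dest (iter _ _ _) _]/(iter k.+1 (dest^~ (nseq N x)) q).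
by rewrite -dest_powseq dest_run.
Qed.

Lemma dest_blockE q i j : dest q (block N i j) =
  dest (dest (dest q (powseq (nseq N a) i)) (powseq (nseq N b) j)) [:: c].
Proof. by rewrite /block !dest_cat. Qed.

Lemma weight_blockE q i j : weight q (block N i j) =
  weight q (powseq (nseq N a) i) +
  (weight (dest q (powseq (nseq N a) i)) (powseq (nseq N b) j) +
   weight (dest (dest q (powseq (nseq N a) i)) (powseq (nseq N b) j)) [:: c]).
Proof. by rewrite /block !weight_cat. Qed.

Lemma dest_block q i j : dest q (block N i.+1 j.+1) = dest q (block N 2 2).
Proof.
by rewrite !dest_blockE !dest_run.
Qed.

(** Weights are affine in the numbers of copies, [c] is always read from the same state, and (3, 1)
    and (1, 3) average to (2, 2). *)
Lemma weight_block q : weight q (block N 3 1) + weight q (block N 1 3) =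
  2 * weight q (block N 2 2).
Proof. by rewrite !weight_blockE !dest_run !weight_run; ring. Qed.

Lemma dest_uniform_word q :
  dest q (uniform_word N) = iter N (dest^~ (block N 2 2)) q.
Proof. by rewrite dest_powseq iterD iter_fact. Qed.

Lemma dest_mixed_word q : dest q (mixed_word N) = dest q (uniform_word N).
Proof.
rewrite dest_uniform_word /mixed_word dest_cat !dest_powseq.
rewrite -[RHS]iter_fact //.
by rewrite !(eq_iter (fun q => dest_block q _ _)).
Qed.

Lemma weight_mixed_word q :
  weight (dest q (mixed_word N)) (mixed_word N) =
  weight (dest q (uniform_word N)) (uniform_word N).
Proof.
rewrite dest_mixed_word dest_uniform_word; set s := iter _ _ _.
have sN : iter N (dest^~ (block N 2 2)) s = s by rewrite /s iter_fact.
rewrite /uniform_word powseqD /mixed_word !weight_cat !dest_powseq.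
(* Both halves start from [s], so blocks of equal index start from the same state and can be
   paired. *)
rewrite (eq_iter (fun q => dest_block q 2 0)) sN !weight_powseq -!big_split /=.
apply: eq_bigr => i _.
rewrite (eq_iter (fun q => dest_block q 2 0)).
rewrite (eq_iter (fun q => dest_block q 0 2)).
by rewrite weight_block mulrDl mul1r.
Qed.

End Deterministic_blind.

End Blocks.

Fixpoint num_states (Sigma : finType) (e : mpexpr Sigma) : nat :=
  match e with
  | EAut _ A _ => #|state A|
  | EMax e1 e2 | EMin e1 e2 | ESum e1 e2 => num_states e1 + num_states e2
  end.

(** One factorial serves all automata of the expression, and equality passes through the pointwise
    operations. *)
Lemma expr_blind (R : realType) (Sigma : finType) (a b c : Sigma)
    (e : mpexpr Sigma) n :
  (num_states e <= n)%N ->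
  expr_value R e (repeat_word c (mixed_word a b c n`!)) =
  expr_value R e (repeat_word c (uniform_word a b c n`!)).
Proof.
elim: e => [f A detA|e1 IH1 e2 IH2|e1 IH1 e2 IH2|e1 IH1 e2 IH2] /= h;
  last first.
- by rewrite IH1 ?IH2 //; lia.
- by rewrite IH1 ?IH2 //; lia.
- by rewrite IH1 ?IH2 //; lia.
have [next nextP] := deterministic_next detA.
have n0 : (0 < (n`! + n`!) * (4 * n`!).+1)%N.
  by rewrite muln_gt0 addn_gt0 fact_gt0.
pose u := uniform_word a b c n`!.
have idem q : dest next (dest next q u) u = dest next q u.
  by rewrite !dest_uniform_word // iter_fact.
rewrite !(det_value_repeat nextP) //.
- by rewrite weight_mixed_word // size_mixed_word size_uniform_word.
- by rewrite -size_eq0 size_uniform_word -lt0n.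
- by rewrite -size_eq0 size_mixed_word -lt0n.
- by move=> q; rewrite !dest_mixed_word.
Qed.

(** * The block-guessing automaton *)

Definition letter : finType := option bool.

(* In a block ended by [None], the automaton counts the letters [Some q], for
   the [q] guessed at the beginning of the block. *)
Definition guess_trans (q : bool) (x : letter) (q' : bool) : bool :=
  (x == None) || (q' == q).

Lemma guess_total q x : exists q', guess_trans q x q'.
Proof. by exists q; rewrite /guess_trans eqxx orbT. Qed.

(** The initial state fixes the guess for the first block, in accordance with the run of
    [guess_mixed]. *)
Definition guess_automaton : wautomaton letter :=
  @WAutomaton letter bool true guess_trans guess_total
    (fun q x _ => (x == Some q)%:R).

Local Notation mixed := (@mixed_word letter (Some true) (Some false) None).
Local Notation uniform := (@uniform_word letter (Some true) (Some false) None).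
Local Notation blk := (@block letter (Some true) (Some false) None).

Lemma count_block N i j q :
  count_mem (Some q) (blk N i j) = (if q then i * N else j * N)%N.
Proof.
rewrite !count_cat !count_powseq !count_nseq /=.
by case: q; rewrite ?eqxx /= ?mul1n ?mul0n ?muln0 ?addn0 ?add0n.
Qed.

Lemma powseq_nseq (T : Type) (x : T) N i : powseq (nseq N x) i = nseq (i * N) x.
Proof. by elim: i => //= i IH; rewrite mulSn nseqD -IH. Qed.

Lemma nth_block N i j k : (k < (i + j) * N)%N ->
  nth None (blk N i j) k = Some (k < i * N)%N.
Proof.
rewrite mulnDl => kN.
rewrite /block !powseq_nseq !nth_cat !nth_nseq !size_nseq.
case: ltnP => // ik; have -> // : (k - i * N < j * N)%N by lia.
Qed.

(** The guess cannot change inside a block, and either guess counts [2 * N] letters. *)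
Lemma guess_uniform (N : nat) (r : nat -> bool) : (0 < N)%N ->
  let w := repeat_word None (uniform N) in
  @is_run letter guess_automaton w r ->
  exists C, forall n, psum (@run_weights letter guess_automaton w r) n <=
    (2 * N)%:R / (4 * N).+1%:R * n%:R + C.
Proof.
move=> N0; rewrite repeat_word_powseq ?addn_gt0 ?N0 // => w [_ rt].
have sB : size (blk N 2 2) = (4 * N).+1 by rewrite size_block.
have rB i k : (k <= 4 * N)%N -> r (i * (4 * N).+1 + k)%N = r (i * (4 * N).+1)%N.
  elim: k => [|k IH] kN; first by rewrite addn0.
  rewrite -IH; last exact: ltnW.
  rewrite addnS; have := rt (i * (4 * N).+1 + k)%N.
  rewrite /= /guess_trans -{1}sB /w repeat_word_block; last by rewrite sB; lia.
  by rewrite nth_block //= => /eqP.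
have wM i : `|@run_weights letter guess_automaton w r i| <= 1.
  by rewrite /run_weights /=; case: eqP; rewrite ?normr1 ?normr0.
apply: (psum_block_le (C := 0) _ wM) => // j.
rewrite addr0; elim: j => [|j IH]; first by rewrite /psum big_ord0 mul0r.
rewrite mulSn addnC psumD -natr1 mulrDl mul1r lerD //.
pose q := r (j * (4 * N).+1)%N.
have -> : psum (fun i => run_weights (A := guess_automaton) w r
        (j * (4 * N).+1 + i)) (4 * N).+1 =
    psum (fun k => (nth None (blk N 2 2) k == Some q)%:R) (size (blk N 2 2)).
  rewrite sB; apply: eq_bigr => k _; rewrite /run_weights /= rB -1?ltnS //.
  by rewrite -{1}sB /w repeat_word_block ?sB.
by rewrite psum_count count_block; case: q.
Qed.

(** Guess [true] in the first half of each period and [false] in the second: every block counts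
    [3 * N] letters. *)
Lemma guess_mixed (N : nat) : (0 < N)%N ->
  let w := repeat_word None (mixed N) in
  exists2 r : nat -> bool, @is_run letter guess_automaton w r &
  exists C, forall n, (3 * N)%:R / (4 * N).+1%:R * n%:R + C <=
    psum (@run_weights letter guess_automaton w r) n.
Proof.
move=> N0 w; pose h := (N * (4 * N).+1)%N.
have sM : size (mixed N) = (h + h)%N by rewrite size_mixed_word mulnDl.
have sP i j : (i + j = 4)%N -> size (powseq (blk N i j) N) = h.
  by move=> ij; rewrite size_powseq size_block ij.
have h0 : (0 < h)%N by rewrite muln_gt0 N0.
have lP i j : (i + j = 4)%N -> nth None (powseq (blk N i j) N) h.-1 = None.
  move=> ij; rewrite -(sP i j ij) nth_last last_powseq_None //.
  by rewrite !last_cat.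
pose r n := (n %% (h + h) < h)%N; exists r.
  split=> [|n]; first by rewrite /r mod0n.
  rewrite /= /guess_trans /r /w /repeat_word sM.
  have nh : (n %% (h + h) < h + h)%N by rewrite ltn_mod addn_gt0 h0.
  rewrite -(addn1 n) -modnDml; set m := (n %% _)%N in nh *.
  (* The guess changes only after the last position of each half, where the letter is [None]. *)
  have [mh|mh] := eqVneq m.+1 h.
    by rewrite nth_cat sP // ifT -?mh // -[m]/(m.+1.-1) mh lP.
  have [mhh|mhh] := eqVneq m.+1 (h + h)%N.
    have -> : m = (h + h.-1)%N by lia.
    by rewrite nth_cat sP // ltnNge leq_addr /= addKn lP.
  rewrite modn_small; last by lia.
  by apply/orP; right; apply/eqP; lia.
have wE j k : (k < h + h)%N -> w (j * (h + h) + k)%N = nth None (mixed N) k.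
  by move=> kh; rewrite -sM /w repeat_word_block ?sM.
(* A period has [N + N] times the weight and the length of one block. *)
have -> : (3 * N)%:R / (4 * N).+1%:R =
    (N * (3 * N) + N * (3 * N))%:R / (h + h)%:R :> rat.
  rewrite -!mulnDl !(natrM _ (N + N)) -mulf_div divff ?mul1r //.
  by rewrite pnatr_eq0; lia.
have wM i : `|@run_weights letter guess_automaton w r i| <= 1.
  by rewrite /run_weights /=; case: eqP; rewrite ?normr1 ?normr0.
apply: (psum_block_ge (C := 0) _ wM) => [|j]; first by rewrite addn_gt0 h0.
rewrite addr0; elim: j => [|j IH]; first by rewrite /psum big_ord0 mul0r.
rewrite [X in psum _ X]mulSn [X in psum _ X]addnC psumD -natr1 mulrDl mul1r.
rewrite lerD // psumD natrD.
have half1 : psum (fun i => run_weights (A := guess_automaton) w r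
    (j * (h + h) + i)) h = (N * (3 * N))%:R.
  rewrite -[in RHS](count_block N 3 1 true) -count_powseq.
  rewrite -(psum_count None) sP //.
  apply: eq_bigr => k _; rewrite /run_weights /= /r wE ?ltn_addr //.
  rewrite modnMDl modn_small ?ltn_addr // ltn_ord.
  by rewrite nth_cat sP // ltn_ord.
have half2 : psum (fun i => run_weights (A := guess_automaton) w r
    (j * (h + h) + (h + i))) h = (N * (3 * N))%:R.
  rewrite -[in RHS](count_block N 1 3 false) -count_powseq.
  rewrite -(psum_count None) sP //.
  apply: eq_bigr => k _; rewrite /run_weights /= /r wE ?ltn_add2l //.
  rewrite modnMDl modn_small ?ltn_add2l // ltnNge leq_addr.
  by rewrite nth_cat sP // ltnNge leq_addr /= addKn.
by rewrite half1 half2.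
Qed.

Section Guess.
Variable R : realType.

Definition guess_lang : qlang R letter :=
  fun w => fine (nondet_value R LimInfAvg guess_automaton w).

Lemma guess_langE w :
  nondet_value R LimInfAvg guess_automaton w = (guess_lang w)%:E.
Proof.
rewrite fineK // fin_numE -ltey -ltNye.
have wb r i : 0 <= @run_weights letter guess_automaton w r i <= 1.
  by rewrite /run_weights /=; case: eqP.
apply/andP; split.
  apply: (@lt_le_trans _ _ (ratr 0)%:E); first exact: ltNyr.
  apply: le_trans (ereal_sup_ubound _); last first.
    exists (fun=> true); last by [].
    by split=> // n; rewrite /= /guess_trans eqxx orbT.
  apply: (@Val_ge _ _ _ _ 0) => n; rewrite mul0r addr0 -(mulr0 n%:R).
  by apply: psum_ge => i; have /andP[] := wb (fun=> true) i.
apply: (@le_lt_trans _ _ (ratr 1)%:E); last exact: ltry.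
apply: ge_ereal_sup => _ [r _ <-].
apply: (@Val_le _ _ _ _ 0) => n; rewrite addr0 mulrC.
by apply: psum_le => i; have /andP[] := wb r i.
Qed.

Lemma guess_lang_not_expr : ~ expr_expressible guess_lang.
Proof.
case=> e he; pose N := (num_states e)`!; have N0 : (0 < N)%N := fact_gt0 _.
have := @expr_blind R letter (Some true) (Some false) None e _ (leqnn _).
rewrite !he -!guess_langE -/N => E.
have up : (nondet_value R LimInfAvg guess_automaton
      (repeat_word None (uniform N)) <=
    (ratr ((2 * N)%:R / (4 * N).+1%:R))%:E)%E.
  apply: ge_ereal_sup => _ [r rr <-].
  by have [C hC] := guess_uniform N0 rr; exact: Val_le hC.
have [r rr [C hC]] := guess_mixed N0.
have : ((ratr ((3 * N)%:R / (4 * N).+1%:R))%:E <=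
    nondet_value R LimInfAvg guess_automaton (repeat_word None (mixed N)))%E.
  apply: le_trans (Val_ge R LimInfAvg hC) _.
  by apply: ereal_sup_ubound; exists r.
rewrite E => /le_trans/(_ up); rewrite lee_fin ler_rat.
by rewrite ler_pM2r ?invr_gt0 ?ltr0n // ler_nat; lia.
Qed.

End Guess.

Theorem theorem6 (R : realType) :
  (exists (Sigma : finType) (L : qlang R Sigma),
      expr_expressible L /\ ~ alt_expressible L) /\
  (exists (Sigma : finType) (L : qlang R Sigma),
      nondet_expressible L /\ ~ expr_expressible L).
Proof.
split.
  exists bool, (@sign_lang R); split; last exact: sign_lang_not_alt.
  by exists sign_expr => w; rewrite sign_langE.
exists letter, (guess_lang R); split; last exact: guess_lang_not_expr.
by exists LimInfAvg, guess_automaton => w; rewrite guess_langE.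
Qed.
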